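(* Let $0<p\le q<\infty$. Let $u=(x_I)_{I\in\mathcal D}\in f_p^q$, $u\ne0$, with atomic decomposition $(u_i,\mathcal G_i,I_i)_{i\in\mathcal N}$. Then the sequence $(\omega_I)_{I\in\mathcal D}$ defined by $$\omega_I=\frac{1}{A_{\frac{2p}{q}}}\,\frac{|I_i|^{1-\frac pq}}{\|u_i\|_{f_q^q}^{q-p}}\,\frac{|x_I|^q|I|}{\|u\|_{f_p^q}^p},\qquad I\in\mathcal G_i,\ i\in\mathcal N,$$ (with $\omega_I:=0$ whenever $x_I=0$) satisfies $$\sum_{I\in\mathcal D}\omega_I\le1,$$ and there exists a constant $C_{p,q}>0$ (depending only on $p,q$) such that for each $\varphi=(\varphi_I)_{I\in\mathcal D}\in\ell^\infty(\mathcal D)$ $$\|\varphi\cdot u\|_{f_p^q}\le C_{p,q}\,\|u\|_{f_p^q}\Big(\sum_{I\in\mathcal D}|\varphi_I|^q\omega_I\Big)^{\frac1q}.$$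
   Context: Dyadic intervals: $\mathcal D$ is the set of all intervals $\left[\frac{k-1}{2^n},\frac{k}{2^n}\right)$ with $n\in\mathbb N_0$, $1\le k\le 2^n$; $|I|$ is the length of $I$. $\ell^\infty(\mathcal D)$ is the space of bounded real sequences indexed by $\mathcal D$. The Haar function $h_I$ is $1$ on the left half of $I$, $-1$ on the right half, $0$ elsewhere. Discrete Triebel-Lizorkin spaces: for $0<p\le q<\infty$ and a real sequence $f=(x_I)_{I\in\mathcal D}$ put $S_q(f)(t)=\big(\sum_{I\in\mathcal D}|x_I|^q1_I(t)\big)^{1/q}$, $t\in[0,1]$, and $\|f\|_{f_p^q}=\|S_q(f)\|_{L^p([0,1])}$; $f_p^q$ is the set of $f$ with $\|f\|_{f_p^q}<\infty$. For $\varphi\in\ell^\infty(\mathcal D)$ and $u=(x_I)_{I\in\mathcal D}$, $\varphi\cdot u=(\varphi_Ix_I)_{I\in\mathcal D}$. Hardy spaces: for $0<p\le2$, a real sequence $f=(x_I)_{I\in\mathcal D}$ is identified with its formal Haar series $\sum_I x_Ih_I$; $S(f)=S_2(f)$, $\|f\|_{H^p}=\|S(f)\|_{L^p([0,1])}$, and $H^p=\{f:\|f\|_{H^p}<\infty\}$. Blocks: a collection $\mathcal C\subseteq\mathcal D$ is a block of dyadic intervals if it has a unique maximal interval $I$ (with respect to inclusion) and, whenever $J\in\mathcal C$, $K\in\mathcal D$ and $J\subseteq K\subseteq I$, then $K\in\mathcal C$. The Carleson constant of a non-empty $\mathcal E\subseteq\mathcal D$ is $\llbracket\mathcal E\rrbracket=\sup_{I\in\mathcal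 E}\frac1{|I|}\sum_{J\in\mathcal E,\,J\subseteq I}|J|$. Atomic decomposition in $H^p$ (known result): for every $0<p\le2$ there is a constant $A_p$, depending only on $p$ and fixed once and for all, such that every $v=\sum_{J\in\mathcal D} v_Jh_J\in H^p$ admits an atomic decomposition $(v_i,\mathcal G_i,I_i)_{i\in\mathcal N}$, i.e. an index set $\mathcal N\subseteq\mathbb N$ and blocks of dyadic intervals $(\mathcal G_i)_{i\in\mathcal N}$ such that, with $v_i=\sum_{J\in\mathcal G_i}v_Jh_J$: (i) $(\mathcal G_i)_{i\in\mathcal N}$ is a disjoint partition of $\mathcal D$; (ii) $I_i:=\bigcup_{J\in\mathcal G_i}J$ is a dyadic interval and $\mathcal E:=\{I_i:i\in\mathcal N\}$ satisfies $\llbracket\mathcal E\rrbracket\le4$; (iii) $\|v\|_{H^p}^p\le\sum_{i\in\mathcal N}\|v_i\|_{H^p}^p\le\sum_{i\in\mathcal N}|I_i|\,\|S(v_i)\|_\infty^p\le A_p\|v\|_{H^p}^p$. Atomic decomposition in $f_p^q$: if $u=(x_I)_{I\in\mathcal D}\in f_p^q$, then $|u|^{q/2}:=(|x_I|^{q/2})_{I\in\mathcal D}\in H^{2p/q}$ with $2p/q\in(0,2]$. If $(|u|^{q/2})$ has atomic decomposition in $H^{2p/q}$ with blocks $\mathcal G_i$ and intervals $I_i$ ($i\in\mathcal N$), then $(u_i,\mathcal G_i,I_i)_{i\in\mathcal N}$, where $u_i=(x_I)_{I\in\mathcal G_i}$ (extended by $0$ outside $\mathcal G_i$), is called an atomic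 decomposition of $u\in f_p^q$. *)

(* Defs.v *)
From mathcomp Require Import all_boot all_order all_algebra.
From mathcomp Require Import all_classical all_reals all_analysis.
Import Order.TTheory GRing.Theory Num.Theory.
Import numFieldNormedType.Exports.

Set Implicit Arguments.
Unset Strict Implicit.
Unset Printing Implicit Defensive.

Local Open Scope classical_set_scope.
Local Open Scope ring_scope.

(* [existT _ n k], with 0 <= k < 2 ^ n, encodes [k / 2^n, (k + 1) / 2^n[ ;
   distinct codes give distinct intervals. *)
Definition dyadic := {n : nat & 'I_(2 ^ n)}.

Definition dlen (R : realType) (I : dyadic) : R := 2 ^- tag I.

Definition ditv (R : realType) (I : dyadic) : set R :=
  `[(tagged I : nat)%:R / 2 ^+ tag I, (tagged I).+1%:R / 2 ^+ tag I[.

Arguments dlen R I : clear implicits.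
Arguments ditv R I : clear implicits.

Definition lebesgue01 (R : realType) :
    {measure set (measurableTypeR R) -> \bar R} :=
  mrestr (@lebesgue_measure R)
    (measurable_itv `[0, 1] : measurable (`[0, 1] : set (measurableTypeR R))).
Arguments lebesgue01 R : clear implicits.

Definition square_fun (R : realType) (q : R) (f : dyadic -> R) (t : R) : \bar R :=
  (poweR (\esum_(I in [set: dyadic]) (`|f I| `^ q * \1_(ditv R I) t)%:E) q^-1)%E.

Definition fnorm (R : realType) (p q : R) (f : dyadic -> R) : \bar R :=
  Lnorm (lebesgue01 R) p%:E (square_fun q f).

(* The formal Haar series sum_I (f I) h_I is identified with the sequence f. *)
Definition hardy_norm (R : realType) (p : R) (f : dyadic -> R) : \bar R :=
  fnorm p 2 f.

Definition drestrict (R : realType) (G : set dyadic) (f : dyadic -> R) :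
    dyadic -> R :=
  patch (fun=> 0) G f.

Definition is_maximal (R : realType) (C : set dyadic) (I : dyadic) : Prop :=
  C I /\ forall J, C J -> ditv R I `<=` ditv R J -> J = I.
Arguments is_maximal R C I : clear implicits.

Definition block (R : realType) (C : set dyadic) : Prop :=
  exists I : dyadic,
    [/\ is_maximal R C I,
        forall I', is_maximal R C I' -> I' = I &
        forall J K, C J -> ditv R J `<=` ditv R K -> ditv R K `<=` ditv R I ->
          C K].
Arguments block R C : clear implicits.

Definition carleson (R : realType) (E : set dyadic) : \bar R :=
  ereal_sup [set ((dlen R I)^-1%:E *
      \esum_(J in [set J | E J /\ ditv R J `<=` ditv R I]) (dlen R J)%:E)%E
    | I in E].
Arguments carleson R E : clear implicits.

Definition atomic_decomposition_Hp (R : realType) (a p : R) (v : dyadic -> R)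
    (N : set nat) (G : nat -> set dyadic) (I : nat -> dyadic) : Prop :=
  [/\ (forall i, N i -> block R (G i)) /\ partition N G [set: dyadic],
      forall i, N i -> \bigcup_(J in G i) ditv R J = ditv R (I i),
      (carleson R (I @` N) <= 4%:E)%E &
      [/\ (poweR (hardy_norm p v) p <=
           \esum_(i in N) poweR (hardy_norm p (drestrict (G i) v)) p)%E,
          (\esum_(i in N) poweR (hardy_norm p (drestrict (G i) v)) p <=
           \esum_(i in N) ((dlen R (I i))%:E *
             poweR (Lnorm (lebesgue01 R) +oo
                     (square_fun 2 (drestrict (G i) v))) p))%E &
          (\esum_(i in N) ((dlen R (I i))%:E *
             poweR (Lnorm (lebesgue01 R) +oo
                     (square_fun 2 (drestrict (G i) v))) p) <=
           a%:E * poweR (hardy_norm p v) p)%E]].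

(* [A] is an admissible choice of the constants p |-> A_p of the atomic
   decomposition theorem for Hardy spaces. *)
Definition atomic_constants (R : realType) (A : R -> R) : Prop :=
  forall p : R, 0 < p -> p <= 2 -> forall v : dyadic -> R,
    (hardy_norm p v < +oo)%E ->
    exists (N : set nat) (G : nat -> set dyadic) (I : nat -> dyadic),
      atomic_decomposition_Hp (A p) p v N G I.

Definition atomic_decomposition_fpq (R : realType) (A : R -> R) (p q : R)
    (u : dyadic -> R) (N : set nat) (G : nat -> set dyadic)
    (I : nat -> dyadic) : Prop :=
  atomic_decomposition_Hp (A (2 * p / q)) (2 * p / q)
    (fun J => `|u J| `^ (q / 2)) N G I.

(* [get] selects the index i of the block G_i that contains J, which is unique
   since the blocks partition the dyadic intervals.  Both norms are finite for
   an atomic decomposition of u in f_p^q, and nonzero when u J != 0, so that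
   [fine] loses no information. *)
Definition omega (R : realType) (A : R -> R) (p q : R) (u : dyadic -> R)
    (N : set nat) (G : nat -> set dyadic) (I : nat -> dyadic)
    (J : dyadic) : R :=
  let i := get [set i | N i /\ G i J] in
  if u J == 0 then 0 else
    (A (2 * p / q))^-1 *
    (dlen R (I i) `^ (1 - p / q) /
       fine (fnorm q q (drestrict (G i) u)) `^ (q - p)) *
    (`|u J| `^ q * dlen R J / fine (fnorm p q u) `^ p).

(* Main.v *)
(* Write r = p/q, l_i = |I_i|, e_i = ||u_i||_{f_q^q}^q and K = A_{2p/q} ||u||^p.
   As S_q(u_i)^q = S(v_i)^2 vanishes off I_i, e_i <= l_i ||S(v_i)||_oo^2, so that
   l_i^(1-r) e_i^r <= l_i ||S(v_i)||_oo^(2p/q), and these numbers add up to at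
   most K; the weights omega of the i-th block add up to l_i^(1-r) e_i^r / K.
   For the second estimate, let F_i be the part of S_q(phi u)^q carried by the
   i-th block and W = sum |phi|^q omega.  Subadditivity of x^r reduces it to
   bounding the integrals of F_i^r.  The two applications of Hoelder's inequality
   (on I_i, then over i) are replaced by the single tangent bound
   x^r <= r l^(r-1) x + (1-r) l^r with the constant l = W e_i / l_i, whose two
   terms integrate and sum to r K W^r and (1-r) K W^r; hence the constant A_{2p/q}^(1/p). *)
Require Import Defs.
From mathcomp Require Import all_boot all_order all_algebra.
From mathcomp Require Import all_classical all_reals all_analysis.
From mathcomp Require Import measurable_realfun ess_sup_inf.
From mathcomp Require Import ring lra.
Import Order.TTheory GRing.Theory Num.Theory.
Import numFieldNormedType.Exports.

Set Implicit Arguments.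
Unset Strict Implicit.
Unset Printing Implicit Defensive.

Local Open Scope classical_set_scope.
Local Open Scope ring_scope.

(** * Nonnegative sums over a countable type: scaling, measurability, exchange with the integral *)

Section CountableSums.
Local Open Scope ereal_scope.
Context {R : realType} {T : countType}.
Implicit Types (D : set T) (f : T -> \bar R).

(** [pickle] turns the unordered sum into a series over the naturals, to which the convergence
    theorems apply; numbers that code no element, or one outside [D], contribute 0. *)
Lemma esum_countE D f : (forall x, 0 <= f x) ->
  \esum_(x in D) f x =
  \sum_(n <oo) oapp (fun x => if x \in D then f x else 0) 0 (pickle_inv n).
Proof.
move=> f0; set g := fun x => if x \in D then f x else 0.
have g0 n : 0 <= oapp g 0 (pickle_inv n).
  by case: (pickle_inv _) => //= x; rewrite /g; case: ifP.
rewrite nneseries_esumT// esum_mkcond.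
have inj : set_inj [set: T] (@pickle T).
  by move=> x y _ _; exact: (pcan_inj (@pickleK T)).
transitivity (\esum_(n in pickle @` [set: T]) oapp g 0 (pickle_inv n)).
  by rewrite esum_image//; apply: eq_esum => x _; rewrite pickleK_inv.
rewrite [LHS]esum_mkcond; apply: eq_esum => n _.
case: ifPn => // /negP nT; case E : (pickle_inv n) => [x|//].
exfalso; apply: nT; rewrite inE; exists x => //.
by have := @pickle_invK T n; rewrite /ocancel E.
Qed.

Lemma esumZl D f (k : R) : (0 <= k)%R -> (forall x, 0 <= f x) ->
  \esum_(x in D) (k%:E * f x) = k%:E * \esum_(x in D) f x.
Proof.
move=> k0 f0; rewrite !esum_countE//; last first.
  by move=> x; rewrite mule_ge0// lee_fin.
rewrite -nneseriesZl; last first.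
  by move=> n _; case: (pickle_inv _) => //= x; case: ifP.
apply: eq_eseriesr => n _; case: (pickle_inv _) => [x|] /=; last by rewrite mule0.
by case: ifP; rewrite ?mule0.
Qed.

Context {d : measure_display} {X : measurableType d}.
Variable mu : {measure set X -> \bar R}.

Lemma measurable_esum D (h : T -> X -> \bar R) :
  (forall x t, 0 <= h x t) -> (forall x, measurable_fun [set: X] (h x)) ->
  measurable_fun [set: X] (fun t => \esum_(x in D) h x t).
Proof.
move=> h0 mh.
under eq_fun do rewrite esum_countE//.
apply: (@ge0_emeasurable_sum _ _ _ setT
  (fun n t => oapp (fun x => if x \in D then h x t else 0) 0 (pickle_inv n))
  xpredT) => [n t _ _|n _].
  by case: (pickle_inv _) => //= x; case: ifP.
by case: (pickle_inv _) => [x|//] /=; case: (x \in D).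
Qed.

Lemma integral_esum D (h : T -> X -> \bar R) :
  (forall x t, 0 <= h x t) -> (forall x, measurable_fun [set: X] (h x)) ->
  \int[mu]_t (\esum_(x in D) h x t) = \esum_(x in D) \int[mu]_t h x t.
Proof.
move=> h0 mh; under eq_integral do rewrite esum_countE//.
rewrite esum_countE; last by move=> x; exact: integral_ge0.
rewrite integral_nneseries//.
- apply: eq_eseriesr => n _; case: (pickle_inv _) => [x|] /=; last first.
    by rewrite integral0.
  by case: ifP => //; rewrite integral0.
- by move=> n; case: (pickle_inv _) => [x|//] /=; case: (x \in D).
- by move=> n t _; case: (pickle_inv _) => [x|//] /=; case: (x \in D).
Qed.

End CountableSums.

(** * Summation by blocks and subadditivity of powers *)

Section ESums.
Local Open Scope ereal_scope.
Context {R : realType} {T : countType}.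

Lemma esum_ge1 (D : set T) (a : T -> \bar R) x : (forall y, 0 <= a y) ->
  D x -> a x <= \esum_(y in D) a y.
Proof.
move=> a0 Dx; apply: esum_ge; exists [set x]; last by rewrite fsbig_set1.
by split => // y ->.
Qed.

Lemma esum_partition (N : set nat) (G : nat -> set T) (a : T -> \bar R) :
  partition N G setT -> (forall x, 0 <= a x) ->
  \esum_(x in [set: T]) a x = \esum_(i in N) \esum_(x in G i) a x.
Proof.
move=> [cG tG _] a0; rewrite -cG /cover.
(* The partition gives disjointness for indices in [N] only; emptying the other blocks gives it for
   all indices. *)
pose G' i := if i \in N then G i else set0.
have -> : \bigcup_(i in N) G i = \bigcup_(i in N) G' i.
  by apply: eq_bigcupr => i Ni; rewrite /G' mem_set.
rewrite esum_bigcupT//; last first.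
  move=> i j _ _; rewrite /G'; case: ifPn; last by rewrite set0I => _ [].
  case: ifPn; last by rewrite setI0 => _ _ [].
  by rewrite !inE => Nj Ni; apply: tG.
by apply: eq_esum => i Ni; rewrite /G' mem_set.
Qed.

(* If T is the right-hand side, each term is a_x = (a_x^r) (a_x^r)^(1/r - 1)
   <= a_x^r T^(1/r - 1), and these bounds add up to T^(1/r). *)
Lemma poweR_esum_le (D : set T) (a : T -> \bar R) (r : R) :
  (0 < r <= 1)%R -> (forall x, 0 <= a x) ->
  (\esum_(x in D) a x) `^ r <= \esum_(x in D) (a x) `^ r.
Proof.
move=> /andP[r0 r1] a0; have rV0 : (0 < r^-1)%R by rewrite invr_gt0.
have ar0 x : 0 <= a x `^ r by exact: poweR_ge0.
case ES : (\esum_(x in D) a x `^ r) => [t| |]; last 2 first.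
- by rewrite leey.
- by have := esum_ge0 (fun x (_ : D x) => ar0 x); rewrite ES.
have t0 : (0 <= t)%R.
  by rewrite -lee_fin -ES; apply: esum_ge0 => x _; exact: ar0.
have ale x : D x -> a x <= (t `^ (r^-1 - 1))%:E * a x `^ r.
  move=> Dx; have := esum_ge1 ar0 Dx; rewrite ES; have := a0 x.
  case: (a x) => [c||//]; last by rewrite poweRyr ?gt_eqF.
  rewrite lee_fin poweR_EFin !lee_fin => c0 ct.
  have {1}-> : c = (c `^ r * (c `^ r) `^ (r^-1 - 1))%R.
    by rewrite mulr_powRB1 ?powR_ge0// -powRrM mulfV ?gt_eqF// powRr1.
  rewrite mulrC ler_wpM2r ?powR_ge0// ge0_ler_powR ?nnegrE ?powR_ge0//.
  by rewrite subr_ge0 invf_ge1.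
have : \esum_(x in D) a x <= (t `^ r^-1)%:E.
  apply: le_trans (le_esum ale) _.
  by rewrite esumZl ?powR_ge0// ES -EFinM mulrC mulr_powRB1.
move=> /(gt0_ler_poweR (ltW r0)); rewrite poweR_EFin -powRrM mulVf ?gt_eqF//.
by rewrite powRr1//; apply; rewrite in_itv/= ?leey ?andbT ?lee_fin ?powR_ge0 ?esum_ge0.
Qed.

End ESums.

(** * Tangent bound for a concave power *)

Section ConcaveTangent.
Context {R : realType}.

(* With e^s = x / l, this is r e^((1-r)s) + (1-r) e^(-rs) >= 1, which follows
   from e^y >= 1 + y. *)
Lemma powR_tangent (r l x : R) : 0 < r <= 1 -> 0 < l -> 0 <= x ->
  x `^ r <= r * l `^ (r - 1) * x + (1 - r) * l `^ r.
Proof.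
move=> /andP[r0 r1] l0; rewrite le_eqVlt => /predU1P[<-|x0].
  by rewrite powR0 ?gt_eqF// mulr0 add0r mulr_ge0 ?powR_ge0 ?subr_ge0.
rewrite /powR !gt_eqF//.
have -> : x = expR (ln x) by rewrite lnK.
rewrite expRK; move: (ln x) (ln l) => s t.
have -> : expR ((r - 1) * t) = expR (r * s) * (expR ((r - 1) * t - r * s)).
  by rewrite -expRD; congr expR; ring.
have -> : expR (r * t) = expR (r * s) * expR (r * (t - s)).
  by rewrite -expRD; congr expR; ring.
have H1 := expR_ge1Dx ((1 - r) * (s - t)).
have H2 := expR_ge1Dx (r * (t - s)).
have H3 : expR ((r - 1) * t - r * s) * expR s = expR ((1 - r) * (s - t)).
  by rewrite -expRD; congr expR; ring.
have -> : r * (expR (r * s) * expR ((r - 1) * t - r * s)) * expR s +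
    (1 - r) * (expR (r * s) * expR (r * (t - s))) =
  expR (r * s) * (r * expR ((1 - r) * (s - t)) + (1 - r) * expR (r * (t - s))).
  by rewrite -H3; ring.
rewrite ler_peMr ?expR_ge0//.
have K1 := ler_wpM2l (ltW r0) H1.
have r1' : 0 <= 1 - r by rewrite subr_ge0.
have K2 := ler_wpM2l r1' H2.
apply: le_trans (lerD K1 K2).
by rewrite le_eqVlt; apply/orP; left; apply/eqP; ring.
Qed.

Lemma poweR_tangent (r l : R) (x : \bar R) : 0 < r <= 1 -> 0 < l ->
  (0 <= x -> poweR x r <= (r * l `^ (r - 1))%:E * x + ((1 - r) * l `^ r)%:E)%E.
Proof.
move=> r01 l0; case: x => [x||//].
  by rewrite lee_fin => x0; rewrite poweR_EFin -EFinM -EFinD lee_fin powR_tangent.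
(* At [x = +oo] the positive slope makes the right-hand side infinite. *)
move=> _; rewrite gt0_muley ?addye ?leey//.
by rewrite lte_fin mulr_gt0 ?powR_gt0//; case/andP: r01.
Qed.

End ConcaveTangent.

(** * Square functions of pieces of a sequence and their integrals *)

Section DyadicSums.
Local Open Scope ereal_scope.
Context {R : realType}.
Implicit Types (p q : R) (f : dyadic -> R) (D : set dyadic).

Lemma dlen_gt0 (J : dyadic) : (0 < dlen R J)%R.
Proof. by rewrite /dlen invr_gt0 exprn_gt0. Qed.

Lemma measurable_ditv (J : dyadic) : measurable (ditv R J : set (measurableTypeR R)).
Proof. exact: measurable_itv. Qed.

Lemma measurable_indic_ditv (J : dyadic) :
  measurable_fun [set: measurableTypeR R] (fun t => (\1_(ditv R J) t : R)%:E).
Proof. by apply/measurable_EFinP; exact: (measurable_indic (measurable_ditv J)). Qed.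

Lemma lebesgue01_ditv (J : dyadic) : lebesgue01 R (ditv R J) = (dlen R J)%:E.
Proof.
rewrite /lebesgue01 /= /mrestr setIidl; last first.
  move=> t; rewrite /ditv /= !in_itv/= => /andP[t0 t1].
  have p0 : (0 < 2 ^+ tag J :> R)%R by rewrite exprn_gt0.
  apply/andP; split; first by apply: le_trans t0; rewrite divr_ge0// ltW.
  by apply: ltW (lt_le_trans t1 _); rewrite ler_pdivrMr// mul1r -natrX ler_nat.
rewrite /ditv lebesgue_measure_itv/= lte_fin ltr_pM2r ?invr_gt0 ?exprn_gt0//.
rewrite ltr_nat ltnSn -EFinB /dlen -mulrBl.
by rewrite -natrB// subSnn mul1r.
Qed.

(** This is the power S_q^q of the part of [f] on [D]; unlike S_q itself, it is additive over
    disjoint blocks. *)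
Definition qsum q D f (t : R) : \bar R :=
  \esum_(J in D) (`|f J| `^ q * \1_(ditv R J) t)%:E.

Lemma qsum_term_ge0 q f (J : dyadic) (t : R) :
  0 <= (`|f J| `^ q * \1_(ditv R J) t)%:E.
Proof. by rewrite lee_fin mulr_ge0 ?powR_ge0. Qed.

Lemma measurable_qsum_term q f (J : dyadic) :
  measurable_fun [set: measurableTypeR R]
    (fun t => (`|f J| `^ q * \1_(ditv R J) t)%:E).
Proof.
apply/measurable_EFinP; apply: measurable_funM => //.
exact: (measurable_indic (measurable_ditv J)).
Qed.

Lemma qsum_ge0 q D f t : 0 <= qsum q D f t.
Proof. by apply: esum_ge0 => J _; exact: qsum_term_ge0. Qed.

Lemma measurable_qsum q D f : measurable_fun [set: measurableTypeR R] (qsum q D f).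
Proof.
apply: measurable_esum => [J t|J]; first exact: qsum_term_ge0.
exact: measurable_qsum_term.
Qed.

Lemma measurable_qsum_poweR q r D f :
  measurable_fun [set: measurableTypeR R] (fun t => qsum q D f t `^ r).
Proof. exact: measurableT_comp (measurable_poweR r) (measurable_qsum q D f). Qed.

Lemma integral_qsum q D f : \int[lebesgue01 R]_t qsum q D f t =
  \esum_(J in D) (`|f J| `^ q * dlen R J)%:E.
Proof.
rewrite integral_esum; last 2 first.
- by move=> J t; exact: qsum_term_ge0.
- by move=> J; exact: measurable_qsum_term.
apply: eq_esum => J _; under eq_integral do rewrite EFinM.
rewrite ge0_integralZl ?lee_fin ?powR_ge0//; last first.
  exact: measurable_indic_ditv.
rewrite integral_indic//; last exact: measurable_ditv.
by rewrite setIT lebesgue01_ditv -EFinM.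
Qed.

Lemma qsum_out q D f (K : dyadic) t : \bigcup_(J in D) ditv R J = ditv R K ->
  ~ ditv R K t -> qsum q D f t = 0.
Proof.
move=> DK Kt; apply: esum1 => J DJ.
rewrite indicE memNset ?mulr0// => Jt; apply: Kt.
by rewrite -DK; exists J.
Qed.

(** Zero to the power zero is 1, so for [q = 0] the zero entries off [D] would still count. *)
Lemma qsum_restrict q D f t : q != 0%R ->
  qsum q setT (drestrict D f) t = qsum q D f t.
Proof.
move=> q0; rewrite [RHS]/qsum esum_mkcond; apply: eq_esum => J _.
by rewrite /drestrict patchE; case: ifP => //; rewrite normr0 powR0// mul0r.
Qed.

Lemma square_funE q f t : square_fun q f t = qsum q setT f t `^ q^-1.
Proof. by []. Qed.

Lemma fnorm_ge0 p q f : 0 <= fnorm p q f.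
Proof. exact: Lnorm_ge0. Qed.

Lemma fnorm_poweR p q f : (0 < p)%R ->
  fnorm p q f `^ p = \int[lebesgue01 R]_t qsum q setT f t `^ (p / q).
Proof.
move=> p0; rewrite /fnorm poweR_Lnorm ?gt_eqF//; apply: eq_integral => t _.
by rewrite gee0_abs ?poweR_ge0// square_funE -poweRrM mulrC.
Qed.

(** This carries the Hardy space decomposition of |u|^(q/2) over to [u]: the squared square function
    of the former is S_q(u)^q. *)
Lemma qsum_halfpower q D f (t : R) : (0 < q)%R ->
  qsum 2 D (fun J => `|f J| `^ (q / 2))%R t = qsum q D f t.
Proof.
move=> q0; apply: eq_esum => J _; congr (_ * _)%:E.
by rewrite ger0_norm ?powR_ge0// -powRrM divfK.
Qed.

(** A nonzero coefficient [f J] keeps the square function above |f J| on the interval of [J], which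
    has positive measure. *)
Lemma fnorm_gt0 p q f : (0 < p)%R -> (0 < q)%R -> f <> (fun=> 0%R) ->
  0 < fnorm p q f.
Proof.
move=> p0 q0 f0; rewrite lt0e fnorm_ge0 andbT; apply/eqP => n0.
have [J fJ] : exists J, f J != 0%R.
  apply: contrapT => h; apply: f0; apply/funext => J.
  by apply: contrapT => /eqP fJ; apply: h; exists J.
have := fnorm_poweR q f p0; rewrite n0 poweR0r ?gt_eqF// => /eqP; rewrite lt_eqF//.
have fJp : (0 < (`|f J| `^ q) `^ (p / q))%R by rewrite !powR_gt0// normr_gt0.
apply: (@lt_le_trans _ _ (\int[lebesgue01 R]_t
    (((`|f J| `^ q) `^ (p / q))%:E * (\1_(ditv R J) t)%:E))).
  rewrite ge0_integralZl ?lee_fin ?(ltW fJp)//; last first.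
    exact: measurable_indic_ditv.
  rewrite integral_indic//; last exact: measurable_ditv.
  by rewrite setIT lebesgue01_ditv -EFinM lte_fin mulr_gt0 ?dlen_gt0.
apply: ge0_le_integral => //.
- apply/measurable_EFinP; apply: measurable_funM => //.
  exact: (measurable_indic (measurable_ditv J)).
- exact: measurable_qsum_poweR.
move=> t _; have [Jt|Jt] := pselect (ditv R J t); last first.
  by rewrite indicE memNset// mule0 poweR_ge0.
rewrite indicE mem_set// mule1 -poweR_EFin gt0_ler_poweR ?in_itv/= ?leey ?andbT//.
- by rewrite divr_ge0 ?ltW.
- exact: qsum_ge0.
apply: le_trans (esum_ge1 (qsum_term_ge0 q f ^~ t) (I : [set: dyadic] J)).
by rewrite indicE mem_set// mulr1.
Qed.

(** The tangent bound at [l] is used on [K] only: off [K] the sum vanishes, so the constant term may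
    carry the indicator of [K] and integrates to a multiple of |K|. *)
Lemma integral_qsum_poweR_le q D f (K : dyadic) (r l : R) :
  \bigcup_(J in D) ditv R J = ditv R K -> (0 < r <= 1)%R -> (0 < l)%R ->
  \int[lebesgue01 R]_t qsum q D f t `^ r <=
  (r * l `^ (r - 1))%:E * (\esum_(J in D) (`|f J| `^ q * dlen R J)%:E) +
  ((1 - r) * l `^ r * dlen R K)%:E.
Proof.
move=> DK r01 l0; have /andP[r0 r1] := r01.
have c0 : (0 <= r * l `^ (r - 1))%R by rewrite mulr_ge0 ?powR_ge0// ltW.
have c1 : (0 <= (1 - r) * l `^ r)%R by rewrite mulr_ge0 ?powR_ge0 ?subr_ge0.
have mK := measurable_indic_ditv K.
apply: (@le_trans _ _ (\int[lebesgue01 R]_t ((r * l `^ (r - 1))%:E * qsum q D f t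
    + ((1 - r) * l `^ r)%:E * (\1_(ditv R K) t)%:E))); last first.
  rewrite ge0_integralD//; last 4 first.
  - by move=> t _; rewrite mule_ge0// qsum_ge0.
  - by apply: measurable_funeM; exact: measurable_qsum.
  - by move=> t _; rewrite mule_ge0.
  - exact: measurable_funeM.
  rewrite ge0_integralZl//; last 2 first.
  - exact: measurable_qsum.
  - by move=> t _; exact: qsum_ge0.
  rewrite integral_qsum ge0_integralZl// integral_indic//; last exact: measurable_ditv.
  by rewrite setIT lebesgue01_ditv -EFinM.
apply: ge0_le_integral => //.
- by move=> t _; exact: poweR_ge0.
- exact: measurable_qsum_poweR.
- apply: emeasurable_funD; apply: measurable_funeM => //.
  exact: measurable_qsum.
move=> t _; have [Kt|Kt] := pselect (ditv R K t).
  by rewrite indicE mem_set// mule1 poweR_tangent// qsum_ge0.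
rewrite indicE memNset// !mule0 adde0 (qsum_out _ _ DK Kt) poweR0r ?gt_eqF//.
by rewrite mule0.
Qed.

Lemma esum_block_le q D f (K : dyadic) : (0 < q)%R ->
  \bigcup_(J in D) ditv R J = ditv R K ->
  \esum_(J in D) (`|f J| `^ q * dlen R J)%:E <=
  (dlen R K)%:E * Lnorm (lebesgue01 R) +oo
    (square_fun 2 (drestrict D (fun J => `|f J| `^ (q / 2))%R)) `^ 2.
Proof.
move=> q0 DK; set g := square_fun _ _; set M := Lnorm _ _ _.
have M0 : 0 <= M by exact: Lnorm_ge0.
have gE t : g t = qsum q D f t `^ 2^-1.
  by rewrite /g square_funE qsum_restrict// qsum_halfpower.
(* The norm of exponent [+oo] is the essential supremum only on a space of positive measure. *)
have mu0 : 0 < lebesgue01 R [set: measurableTypeR R].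
  by rewrite /lebesgue01 /= /mrestr setTI lebesgue_measure_itv/= lte01 sube0 lte01.
have gM : \forall t \ae (lebesgue01 R), qsum q D f t <= M `^ 2 * (\1_(ditv R K) t)%:E.
  have : \forall t \ae (lebesgue01 R), `|g t| <= M.
    by rewrite /M unlock mu0; exact: ess_sup_ge.
  apply: (@filterS _ _ (ae_filter_ringOfSetsType (lebesgue01 R))) => t gt.
  have [Kt|Kt] := pselect (ditv R K t); last first.
    by rewrite (qsum_out _ _ DK Kt) mule_ge0 ?poweR_ge0 ?lee_fin.
  rewrite indicE mem_set// mule1.
  have := @gt0_ler_poweR R 2 (ler0n _ 2) `|g t| M.
  rewrite !in_itv/= !leey !andbT abse_ge0 => /(_ isT M0 gt).
  rewrite gee0_abs ?gE ?poweR_ge0// -poweRrM mulVf// poweRe1//.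
  exact: qsum_ge0.
have mK := measurable_indic_ditv K.
rewrite -integral_qsum.
apply: (@le_trans _ _ (\int[lebesgue01 R]_t (M `^ 2 * (\1_(ditv R K) t)%:E))).
  apply: ae_ge0_le_integral => //.
  - by move=> t _; exact: qsum_ge0.
  - exact: measurable_qsum.
  - by move=> t _; rewrite mule_ge0 ?poweR_ge0 ?lee_fin.
  - exact: measurable_funeM.
  by apply: (@filterS _ _ (ae_filter_ringOfSetsType (lebesgue01 R))) gM => t + _.
rewrite ge0_integralZl ?poweR_ge0// integral_indic//; last exact: measurable_ditv.
by rewrite setIT lebesgue01_ditv muleC.
Qed.

End DyadicSums.

(** * Total weight and multiplier estimate for abstract data [r], [K], [e] *)

Section Weights.
Local Open Scope ereal_scope.
Context {R : realType}.
Variables (q r K : R) (u w : dyadic -> R).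
Variables (N : set nat) (G : nat -> set dyadic) (I : nat -> dyadic) (e : nat -> R).
Hypotheses (q0 : (0 < q)%R) (r01 : (0 < r <= 1)%R) (K0 : (0 < K)%R).
Hypothesis GP : partition N G [set: dyadic].
Hypothesis GI : forall i, N i -> \bigcup_(J in G i) ditv R J = ditv R (I i).
Hypothesis eE : forall i, N i ->
  \esum_(J in G i) (`|u J| `^ q * dlen R J)%:E = (e i)%:E.
Hypothesis sum_le : \esum_(i in N) (dlen R (I i) `^ (1 - r) * e i `^ r)%:E <= K%:E.
(** If [e i = 0], then [u] vanishes on the i-th block, so the value given to the power [r - 1] of 0
    is immaterial. *)
Hypothesis wE : forall i J, N i -> G i J -> w J =
  (K^-1 * dlen R (I i) `^ (1 - r) * e i `^ (r - 1) * (`|u J| `^ q * dlen R J))%R.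

Let r0 : (0 < r)%R. Proof. by case/andP: r01. Qed.
Let r1 : (0 <= 1 - r)%R. Proof. by rewrite subr_ge0; case/andP: r01. Qed.

Let N_G (J : dyadic) : exists2 i, N i & G i J.
Proof. by case: GP => cG _ _; have : [set: dyadic] J by []; rewrite -cG. Qed.

Let term_ge0 (f : dyadic -> R) J : 0 <= (`|f J| `^ q * dlen R J)%:E.
Proof. by rewrite lee_fin mulr_ge0 ?powR_ge0// ltW ?dlen_gt0. Qed.

Let e_ge0 i : N i -> (0 <= e i)%R.
Proof. by move=> Ni; rewrite -lee_fin -eE//; apply: esum_ge0. Qed.

Lemma weight_ge0 J : (0 <= w J)%R.
Proof.
have [i Ni GiJ] := N_G J.
by rewrite (wE Ni GiJ) !mulr_ge0 ?powR_ge0 ?invr_ge0 ?ltW ?dlen_gt0.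
Qed.

Lemma sum_weight_le1 : \esum_(J in [set: dyadic]) (w J)%:E <= 1.
Proof.
rewrite (esum_partition GP); last by move=> J; rewrite lee_fin weight_ge0.
have -> : \esum_(i in N) \esum_(J in G i) (w J)%:E =
    \esum_(i in N) ((K^-1)%:E * (dlen R (I i) `^ (1 - r) * e i `^ r)%:E).
  apply: eq_esum => i Ni.
  under eq_esum => J GiJ do rewrite (wE Ni GiJ) EFinM.
  rewrite esumZl ?eE//; last first.
    by rewrite !mulr_ge0 ?powR_ge0// invr_ge0 ltW.
  (* Here e e^(r-1) = e^r, which survives [e i = 0] because [0 < r]. *)
  rewrite -!EFinM -[in RHS](mulr_powRB1 (e_ge0 Ni) r0); congr EFin; ring.
rewrite esumZl ?invr_ge0 ?(ltW K0)//; last first.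
  by move=> i; rewrite lee_fin mulr_ge0 ?powR_ge0.
apply: (@le_trans _ _ ((K^-1)%:E * K%:E)).
  by rewrite lee_wpmul2l// lee_fin invr_ge0 ltW.
by rewrite -EFinM mulVf ?gt_eqF.
Qed.

Variable phi : dyadic -> R.
Let v J := (phi J * u J)%R.

Let pw_ge0 J : 0 <= (`|phi J| `^ q * w J)%:E.
Proof. by rewrite lee_fin mulr_ge0 ?powR_ge0 ?weight_ge0. Qed.

(* The tangent parameter is s * (average of |u|^q over the block): it makes both
   terms of the tangent bound proportional to quantities summable over i. *)
Lemma integral_block_le (s : R) i : (0 < s)%R -> N i ->
  \int[lebesgue01 R]_t qsum q (G i) v t `^ r <=
  (r * K * s `^ (r - 1))%:E * (\esum_(J in G i) (`|phi J| `^ q * w J)%:E) +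
  ((1 - r) * s `^ r)%:E * (dlen R (I i) `^ (1 - r) * e i `^ r)%:E.
Proof.
move=> s0 Ni.
have l0 := @dlen_gt0 R (I i).
have rhs0 : 0 <= (r * K * s `^ (r - 1))%:E * (\esum_(J in G i) (`|phi J| `^ q * w J)%:E) +
    ((1 - r) * s `^ r)%:E * (dlen R (I i) `^ (1 - r) * e i `^ r)%:E.
  rewrite adde_ge0// mule_ge0 ?esum_ge0//.
  - by rewrite lee_fin !mulr_ge0 ?powR_ge0// ltW.
  - by rewrite lee_fin !mulr_ge0 ?powR_ge0// ltW.
  - by rewrite lee_fin !mulr_ge0 ?powR_ge0// ltW.
(* The tangent parameter must be positive. If [e i = 0], every [u J] of the block vanishes and so
   does the integrand. *)
have := e_ge0 Ni; rewrite le_eqVlt => /predU1P[/esym ei0|ei0].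
  rewrite integral0_eq// => t _; rewrite /qsum esum1 ?poweR0r ?gt_eqF// => J GiJ.
  have := esum_ge1 (term_ge0 u) GiJ; rewrite eE// ei0 lee_fin => uJ.
  have : (`|u J| `^ q * dlen R J == 0)%R.
    by rewrite eq_le uJ -lee_fin term_ge0.
  rewrite mulf_eq0 (gt_eqF (@dlen_gt0 R J)) orbF powR_eq0 normr_eq0 => /andP[/eqP uJ0 _].
  by rewrite /v uJ0 mulr0 normr0 powR0 ?gt_eqF// mul0r.
have lam0 : (0 < s * (e i / dlen R (I i)))%R by rewrite mulr_gt0// divr_gt0.
apply: le_trans (integral_qsum_poweR_le q v (GI Ni) r01 lam0) _.
(* With l = |I_i| and e = [e i], both terms agree exactly: (s e / l)^(r-1) |u J|^q |J| = K s^(r-1)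
   w_J and (s e / l)^r l = s^r l^(1-r) e^r. *)
rewrite le_eqVlt; apply/orP; left; apply/eqP; congr (_ + _).
  rewrite -!esumZl ?mulr_ge0 ?powR_ge0 ?(ltW r0) ?(ltW K0)//.
  apply: eq_esum => J GiJ; rewrite -!EFinM (wE Ni GiJ) /v normrM.
  rewrite !powRM ?(ltW s0) ?(ltW ei0) ?invr_ge0 ?(ltW l0)//; last first.
    by rewrite divr_ge0 ?ltW.
  rewrite -powR_inv1 ?(ltW l0)// -powRrM mulN1r opprB; congr EFin.
  by field; rewrite gt_eqF.
rewrite -EFinM; congr EFin.
rewrite !powRM ?(ltW s0) ?(ltW ei0) ?invr_ge0 ?(ltW l0)//; last first.
  by rewrite divr_ge0 ?ltW.
rewrite -powR_inv1 ?(ltW l0)// -powRrM mulN1r powRB ?(gt_eqF l0) ?implybT//.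
rewrite powRr1 ?(ltW l0)// powRN; ring.
Qed.

(** A positive real bound [s] stands in for W in the tangent parameter, so that the values 0 and
    [+oo] of W can be treated afterwards. *)
Lemma integral_multiplier_le_fin (s : R) : (0 < s)%R ->
  \esum_(J in [set: dyadic]) (`|phi J| `^ q * w J)%:E <= s%:E ->
  \int[lebesgue01 R]_t qsum q setT v t `^ r <= (K * s `^ r)%:E.
Proof.
move=> s0 Ws.
have c0 : (0 <= r * K * s `^ (r - 1))%R by rewrite !mulr_ge0 ?powR_ge0// ltW.
have c1 : (0 <= (1 - r) * s `^ r)%R by rewrite !mulr_ge0 ?powR_ge0// ltW.
apply: (@le_trans _ _ (\int[lebesgue01 R]_t
    (\esum_(i in N) qsum q (G i) v t `^ r))).
  apply: ge0_le_integral => //.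
  - by move=> t _; exact: poweR_ge0.
  - exact: measurable_qsum_poweR.
  - apply: measurable_esum => [i t|i]; first exact: poweR_ge0.
    exact: measurable_qsum_poweR.
  move=> t _; rewrite {1}/qsum (esum_partition GP (qsum_term_ge0 q v ^~ t)).
  by apply: poweR_esum_le => // i; exact: qsum_ge0.
rewrite integral_esum; last 2 first.
- by move=> i t; exact: poweR_ge0.
- by move=> i; exact: measurable_qsum_poweR.
apply: le_trans (le_esum (fun i Ni => integral_block_le s0 Ni)) _.
rewrite esumD; last 2 first.
- by move=> i _; rewrite mule_ge0// ?esum_ge0.
- by move=> i _; rewrite mule_ge0// lee_fin mulr_ge0 ?powR_ge0.
rewrite !esumZl//; last 2 first.
- by move=> i; rewrite lee_fin mulr_ge0 ?powR_ge0.
- by move=> i; rewrite esum_ge0.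
rewrite -(esum_partition GP pw_ge0).
(* Since W <= s, the first contribution is at most r K s^r; the second is at most (1-r) K s^r. *)
have -> : (K * s `^ r)%:E =
    (r * K * s `^ (r - 1))%:E * s%:E + ((1 - r) * s `^ r)%:E * K%:E.
  rewrite -!EFinM -EFinD -[in LHS](mulr_powRB1 (ltW s0) r0).
  by rewrite -[in RHS](mulr_powRB1 (ltW s0) r0); congr EFin; ring.
by rewrite leeD// lee_wpmul2l// lee_fin.
Qed.

Lemma integral_multiplier_le :
  \int[lebesgue01 R]_t qsum q setT v t `^ r <=
  K%:E * (\esum_(J in [set: dyadic]) (`|phi J| `^ q * w J)%:E) `^ r.
Proof.
case EW : (\esum_(J in _) _) => [c| |]; last 2 first.
- by rewrite poweRyr ?gt_eqF// gt0_muley ?leey.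
- have := @esum_ge0 _ _ [set: dyadic] _ (fun J _ => pw_ge0 J).
  by rewrite EW.
have : (0 <= c)%R.
  by rewrite -lee_fin -EW esum_ge0.
rewrite le_eqVlt => /predU1P[c0|c0]; last first.
  by rewrite poweR_EFin -EFinM integral_multiplier_le_fin// EW.
rewrite -c0 poweR0r ?gt_eqF// mule0; apply/lee_addgt0Pr => x x0.
(* In the case W = 0 this [s] solves K s^r = x, and [x > 0] is arbitrary. *)
have s0 : (0 < (x / K) `^ r^-1)%R by rewrite powR_gt0 ?divr_gt0.
rewrite add0e; apply: le_trans (integral_multiplier_le_fin s0 _) _.
  by rewrite EW -c0 lee_fin ltW.
rewrite -powRrM mulVf ?gt_eqF// powRr1 ?divr_ge0 ?(ltW x0) ?(ltW K0)//.
by rewrite mulrC divfK ?gt_eqF.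
Qed.

End Weights.

(** * Specialization to an atomic decomposition of [u] *)

Theorem corollary3p2 (R : realType) (A : R -> R) (hA : atomic_constants A)
    (p q : R) (hp : 0 < p) (hpq : p <= q) :
  exists C : R, 0 < C /\
    forall (u : dyadic -> R) (N : set nat) (G : nat -> set dyadic)
           (I : nat -> dyadic),
      (fnorm p q u < +oo)%E ->
      u <> (fun=> 0) ->
      atomic_decomposition_fpq A p q u N G I ->
      (\esum_(J in [set: dyadic]) (omega A p q u N G I J)%:E <= 1)%E /\
      forall phi : dyadic -> R,
        [bounded phi J | J in [set: dyadic]] ->
        (fnorm p q (fun J => phi J * u J)%R <=
         C%:E * fnorm p q u *
         poweR (\esum_(J in [set: dyadic])
                  (`|phi J| `^ q * omega A p q u N G I J)%:E) q^-1)%E.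
Proof.
have q0 : 0 < q := lt_le_trans hp hpq.
have r01 : 0 < p / q <= 1 by rewrite divr_gt0// ler_pdivrMr// mul1r.
have /andP[r0 r1] := r01.
set a := A (2 * p / q).
(* [0 < a] is only known once some nonzero [u] is given, hence the maximum. *)
exists (Num.max a 1 `^ p^-1); split.
  by rewrite powR_gt0// lt_max ltr01 orbT.
move=> u N G I ufin u0 [[_ GP] GI _ [chain1 chain2 chain3]].
have un0 := fnorm_gt0 hp q0 u0.
pose U := fine (fnorm p q u) `^ p.
have uE : fnorm p q u = (fine (fnorm p q u))%:E.
  by rewrite fineK// ge0_fin_numE// ltW.
have fu0 : 0 < fine (fnorm p q u) by rewrite -lte_fin -uE.
have U0 : 0 < U by rewrite powR_gt0.
pose v J := `|u J| `^ (q / 2).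
have s0 : 0 < 2 * p / q by rewrite divr_gt0 ?mulr_gt0.
have s2 : 2 * p / q / 2 = p / q by field; rewrite gt_eqF.
(* Pointwise S(v)^(2p/q) = S_q(u)^p, so the two norms agree once raised to their exponents. *)
have vU : poweR (hardy_norm (2 * p / q) v) (2 * p / q) = U%:E.
  rewrite /hardy_norm fnorm_poweR// s2.
  under eq_integral do rewrite qsum_halfpower//.
  by rewrite -fnorm_poweR// uE poweR_EFin.
pose M i := Lnorm (lebesgue01 R) +oo (square_fun 2 (drestrict (G i) v)).
have M0 i : (0 <= M i)%E by exact: Lnorm_ge0.
have sumM : (\esum_(i in N) ((dlen R (I i))%:E * poweR (M i) (2 * p / q)) <=
    (a * U)%:E)%E by rewrite EFinM -vU.
(* The chain of inequalities collapses to U <= a U with U > 0, which even gives a >= 1. *)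
have a0 : 0 < a.
  have : (U%:E <= (a * U)%:E)%E.
    by apply: le_trans sumM; rewrite -vU; exact: le_trans chain1 chain2.
  by rewrite lee_fin -{1}(mul1r U) ler_pM2r// => /(lt_le_trans ltr01).
have K0 : 0 < a * U by rewrite mulr_gt0.
pose e i := (\esum_(J in G i) (`|u J| `^ q * dlen R J)%:E)%E.
have term_ge0 J : (0 <= (`|u J| `^ q * dlen R J)%:E)%E.
  by rewrite lee_fin mulr_ge0 ?powR_ge0// ltW ?dlen_gt0.
have e0 i : (0 <= e i)%E by exact: esum_ge0.
have Mt0 i : (0 <= (dlen R (I i))%:E * poweR (M i) (2 * p / q))%E.
  by rewrite mule_ge0 ?poweR_ge0// lee_fin ltW ?dlen_gt0.
have eM i : N i -> (e i <= (dlen R (I i))%:E * poweR (M i) 2)%E.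
  by move=> Ni; exact: esum_block_le q0 (GI i Ni).
have efin i : N i -> e i = (fine (e i))%:E.
  move=> Ni; rewrite fineK// ge0_fin_numE//; apply: le_lt_trans (eM i Ni) _.
  (* A term of a finite sum is finite and |I_i| > 0, so [M i] cannot be [+oo]. *)
  have := le_lt_trans (le_trans (esum_ge1 Mt0 Ni) sumM) (ltry _).
  case: (M i) (M0 i) => [m _ _|_|//].
    by rewrite poweR_EFin -EFinM ltry.
  by rewrite poweRyr ?gt_eqF// gt0_muley ?lte_fin ?dlen_gt0// ltxx.
have sum_le : (\esum_(i in N)
    (dlen R (I i) `^ (1 - p / q) * fine (e i) `^ (p / q))%:E <= (a * U)%:E)%E.
  apply: le_trans sumM; apply: le_esum => i Ni.
  have l0 := @dlen_gt0 R (I i).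
  rewrite EFinM -(poweR_EFin (fine (e i))) -efin//.
  have := gt0_ler_poweR (ltW r0) _ _ (eM i Ni).
  rewrite !in_itv/= !leey !andbT e0 mule_ge0 ?lee_fin ?(ltW l0) ?poweR_ge0//.
  move=> /(_ isT isT) eMr.
  (* The exponents balance: with l = |I_i|, l^(1-r) (l M^2)^r = l M^(2r) for r = p/q. *)
  have -> : ((dlen R (I i))%:E * poweR (M i) (2 * p / q) = (dlen R (I i) `^ (1 - p / q))%:E *
     poweR ((dlen R (I i))%:E * poweR (M i) 2) (p / q))%E.
    rewrite poweRM ?poweR_ge0 ?lee_fin ?(ltW l0)// -poweRrM mulrA poweR_EFin.
    rewrite muleA -EFinM -powRD ?(gt_eqF l0) ?implybT//.
    by rewrite subrK powRr1// ltW.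
  by rewrite lee_wpmul2l// lee_fin powR_ge0.
have wE i J : N i -> G i J -> omega A p q u N G I J =
    (a * U)^-1 * dlen R (I i) `^ (1 - p / q) * fine (e i) `^ (p / q - 1) *
      (`|u J| `^ q * dlen R J).
  move=> Ni GiJ; rewrite /omega.
  have -> : get [set i | N i /\ G i J] = i.
    have [Nj GjJ] : [set i | N i /\ G i J] (get [set i | N i /\ G i J]).
      by apply: (@getPex _ [set i | N i /\ G i J]); exists i.
    by have [_ tG _] := GP; apply: tG => //; exists J.
  have [->|uJ] := eqVneq (u J) 0.
    by rewrite normr0 powR0 ?gt_eqF// mul0r mulr0.
  (* [e i] is the q-th power of this norm, and q - p = q (1 - p/q). *)
  have -> : fine (fnorm q q (drestrict (G i) u)) `^ (q - p) =
      fine (e i) `^ (1 - p / q).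
    have -> : fine (e i) = fine (fnorm q q (drestrict (G i) u)) `^ q.
      rewrite -fine_poweR fnorm_poweR// divff ?gt_eqF//; congr fine.
      rewrite /e -integral_qsum; apply: eq_integral => t _.
      by rewrite qsum_restrict ?gt_eqF// poweRe1// qsum_ge0.
    by rewrite -powRrM; congr powR; field; rewrite gt_eqF.
  rewrite -(opprB 1 (p / q)) powRN -/a -/U invfM; ring.
split; first exact: (sum_weight_le1 r01 K0 GP efin sum_le wE).
move=> phi _.
have := integral_multiplier_le q0 r01 K0 GP GI efin sum_le wE phi.
rewrite -fnorm_poweR//.
set W := esum _ _ => UW.
have W0 : (0 <= W)%E.
  by apply: esum_ge0 => J _; rewrite lee_fin mulr_ge0 ?powR_ge0 ?(weight_ge0 K0 GP wE).
have pV0 : 0 <= p^-1 by rewrite invr_ge0 ltW.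
(* Taking p-th roots turns a ||u||^p W^(p/q) into a^(1/p) ||u|| W^(1/q). *)
have := gt0_ler_poweR pV0 _ _ UW.
rewrite !in_itv/= !leey !andbT poweR_ge0 mule_ge0 ?poweR_ge0 ?lee_fin ?(ltW K0)//.
move=> /(_ isT isT).
rewrite -poweRrM mulfV ?gt_eqF// poweRe1 ?fnorm_ge0//.
rewrite poweRM ?poweR_ge0 ?lee_fin ?(ltW K0)// -poweRrM.
have -> : p / q * p^-1 = q^-1 by field; rewrite !gt_eqF.
move=> /le_trans; apply; rewrite lee_wpmul2r ?poweR_ge0//.
rewrite uE -EFinM poweR_EFin lee_fin powRM ?(ltW a0) ?(ltW U0)//.
rewrite /U -powRrM mulfV ?gt_eqF// powRr1 ?(ltW fu0)//.
rewrite ler_wpM2r ?(ltW fu0)// ge0_ler_powR ?nnegrE ?(ltW a0)//.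
  by rewrite le_max (ltW a0).
by rewrite le_max lexx.
Qed.
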